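(* Let $A\in\mathbb{R}^{n\times n}$, $B\in\mathbb{R}^{n\times m}$, let $Q\in\mathbb{R}^{n\times n}$ and $R\in\mathbb{R}^{m\times m}$ be positive definite, and let $\gamma>0$. Define $V_0,V_1,V_2,\ldots$ for $x\in\mathbb{R}^n$ and positive semi-definite $Z\in\mathbb{R}^{2n\times 2n}$ by $$V_0(x,Z)=-\gamma^2\min_{i=\pm1}\left\|\begin{bmatrix}I& iA\end{bmatrix}^\top\right\|^2_Z,\qquad V_{k+1}(x,Z)=\mathcal{F}V_k(x,Z),$$ where $\mathcal{F}$ is the Bellman operator defined in the context. Then the values of Problem I and Problem II (defined in the context) are finite (for every initial state $x_0$) if and only if the sequence $\{V_k(x,0)\}_{k=0}^\infty$ is upper bounded (for every $x\in\mathbb{R}^n$). In that case the limit $V_*:=\lim_{k\to\infty}V_k$ exists, and $V_*(x_0,0)$ is equal to the value of Problem I and to the value of Problem II with initial state $x_0$. Moreover, defining $\eta(x,Z)$ as the minimizing value of $u$ in the expression for $\mathcal{F}V_*(x,Z)$ gives an optimal $\eta$ for Problem II, while the control law $\mu$ defined by $$\mu_t(x_0,\ldots,x_t,u_0,\ldots,u_{t-1})=\eta\left(x_t,\sum_{\tau=0}^{t-1}\begin{bmatrix}Bu_\tau-x_{\tau+1}\\ x_\tau\end{bmatrix}\begin{bmatrix}Bu_\tau-x_{\tau+1}\\ x_\tau\end{bmatrix}^\top\right)$$ is optimal for Problem I.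
   Context: Notation: $|x|_M^2=x^\top Mx$ and $|x|^2=x^\top x$ for vectors; $\|N\|_M^2=\operatorname{trace}(N^\top MN)$ for matrices. $I$ is the $n\times n$ identity; $\begin{bmatrix}I& iA\end{bmatrix}^\top$ is the $2n\times n$ matrix with blocks $I$ and $iA^\top$ ($i\in\{-1,1\}$ is a sign). Problem I: for a given $x_0\in\mathbb{R}^n$, the value is $$\inf_\mu\sup_{w,i,N}\sum_{t=0}^N\left(|x_t|_Q^2+|u_t|_R^2-\gamma^2|w_t|^2\right),$$ where $i\in\{-1,1\}$, $w_t\in\mathbb{R}^n$, $N\ge0$, and $x,u$ are generated by $x_{t+1}=iAx_t+Bu_t+w_t$ for $t\ge0$ and $u_t=\mu_t(x_0,\ldots,x_t,u_0,\ldots,u_{t-1})$; the infimum is over control laws $\mu=(\mu_t)_{t\ge0}$. Problem II: for a given $x_0\in\mathbb{R}^n$, the value is $$\inf_\eta\sup_{v,N}\left[\sum_{t=0}^N\left(|x_t|_Q^2+|u_t|_R^2\right)-\gamma^2\min_{i=\pm1}\left\|\begin{bmatrix}I& iA\end{bmatrix}^\top\right\|^2_{Z_{N+1}}\right],$$ where $N\ge 0$, $v_t\in\mathbb{R}^n$, and $x,u,Z$ are generated by $x_{t+1}=v_t$, $Z_{t+1}=Z_t+\begin{bmatrix}Bu_t-v_t\\ x_t\end{bmatrix}\begin{bmatrix}Bu_t-v_t\\ x_t\end{bmatrix}^\top$, $Z_0=0$, and $u_t=\eta(x_t,Z_t)$; the infimum is over control laws $\eta$. A control law is optimal for a problem if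 it attains the infimum for every initial state $x_0$. Bellman operator: for a function $V(x,Z)$, $$\mathcal{F}V(x,Z):=\min_{u\in\mathbb{R}^m}\max_{v\in\mathbb{R}^n}\left\{|x|_Q^2+|u|_R^2+V\left(v,\,Z+\begin{bmatrix}Bu-v\\ x\end{bmatrix}\begin{bmatrix}Bu-v\\ x\end{bmatrix}^\top\right)\right\},$$ where $\min$ and $\max$ are read as infimum and supremum with values in $\mathbb{R}\cup\{+\infty\}$ when they are not attained. *)

(* Defs.v *)
From HB Require Import structures.
From mathcomp Require Export all_boot all_order all_algebra.
From mathcomp Require Export all_classical all_reals all_analysis.

Set Implicit Arguments.
Unset Strict Implicit.
Unset Printing Implicit Defensive.

Import Order.TTheory GRing.Theory Num.Theory.
Import numFieldNormedType.Exports.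

Local Open Scope classical_set_scope.
Local Open Scope ring_scope.

Section Quadratic.
Context {R : realType}.

Definition qnorm (p : nat) (M : 'M[R]_p) (x : 'cV[R]_p) : R :=
  (x^T *m M *m x) ord0 ord0.

Definition sqnorm (p : nat) (x : 'cV[R]_p) : R := (x^T *m x) ord0 ord0.

Definition mxqnorm (p q : nat) (M : 'M[R]_p) (N : 'M[R]_(p, q)) : R :=
  \tr (N^T *m M *m N).

(* As usual for real matrices, (semi)definiteness includes symmetry. *)
Definition posdef (p : nat) (M : 'M[R]_p) : Prop :=
  M^T = M /\ forall x : 'cV[R]_p, x != 0 -> 0 < qnorm M x.

Definition possemidef (p : nat) (M : 'M[R]_p) : Prop :=
  M^T = M /\ forall x : 'cV[R]_p, 0 <= qnorm M x.

End Quadratic.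

Section Game.
Context {R : realType} {n m : nat}.
Variables (A : 'M[R]_n) (B : 'M[R]_(n, m)) (Q : 'M[R]_n) (S : 'M[R]_m).
Variable gamma : R.

Definition min_sign_norm (Z : 'M[R]_(n + n)) : R :=
  Num.min (mxqnorm Z (row_mx 1%:M (1 *: A))^T)
          (mxqnorm Z (row_mx 1%:M ((-1) *: A))^T).

Definition datum (x : 'cV[R]_n) (u : 'cV[R]_m) (v : 'cV[R]_n) :
    'M[R]_(n + n) :=
  col_mx (B *m u - v) x *m (col_mx (B *m u - v) x)^T.

(* The t-th component receives x_0, ..., x_t and u_0, ..., u_(t-1). *)
Definition history_law : Type :=
  forall t : nat, ('I_t.+1 -> 'cV[R]_n) -> ('I_t -> 'cV[R]_m) -> 'cV[R]_m.

Definition generates1 (mu : history_law) (x0 : 'cV[R]_n) (i : R)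
    (w x : nat -> 'cV[R]_n) (u : nat -> 'cV[R]_m) : Prop :=
  [/\ x 0%N = x0,
      forall t, x t.+1 = (i *: A) *m x t + B *m u t + w t
    & forall t, u t = mu t (fun s : 'I_t.+1 => x s) (fun s : 'I_t => u s)].

Definition cost1 (mu : history_law) (x0 : 'cV[R]_n) : \bar R :=
  ereal_sup [set J | exists (w : nat -> 'cV[R]_n) (i : R) (N : nat)
      (x : nat -> 'cV[R]_n) (u : nat -> 'cV[R]_m),
    [/\ i = 1 \/ i = -1, generates1 mu x0 i w x u
      & J = (\sum_(t < N.+1)
               (qnorm Q (x t) + qnorm S (u t) - gamma ^+ 2 * sqnorm (w t)))%:E]].

Definition value1 (x0 : 'cV[R]_n) : \bar R :=
  ereal_inf (range (fun mu => cost1 mu x0)).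

Definition optimal1 (mu : history_law) : Prop :=
  forall x0, cost1 mu x0 = value1 x0.

Definition state_law : Type := 'cV[R]_n -> 'M[R]_(n + n) -> 'cV[R]_m.

Definition generates2 (eta : state_law) (x0 : 'cV[R]_n)
    (v x : nat -> 'cV[R]_n) (u : nat -> 'cV[R]_m)
    (Z : nat -> 'M[R]_(n + n)) : Prop :=
  [/\ x 0%N = x0 /\ Z 0%N = 0,
      forall t, x t.+1 = v t,
      forall t, Z t.+1 = Z t + datum (x t) (u t) (v t)
    & forall t, u t = eta (x t) (Z t)].

Definition cost2 (eta : state_law) (x0 : 'cV[R]_n) : \bar R :=
  ereal_sup [set J | exists (v : nat -> 'cV[R]_n) (N : nat)
      (x : nat -> 'cV[R]_n) (u : nat -> 'cV[R]_m) (Z : nat -> 'M[R]_(n + n)),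
    generates2 eta x0 v x u Z /\
    J = (\sum_(t < N.+1) (qnorm Q (x t) + qnorm S (u t))
         - gamma ^+ 2 * min_sign_norm (Z N.+1))%:E].

Definition value2 (x0 : 'cV[R]_n) : \bar R :=
  ereal_inf (range (fun eta => cost2 eta x0)).

Definition optimal2 (eta : state_law) : Prop :=
  forall x0, cost2 eta x0 = value2 x0.

Definition bellman_obj (V : 'cV[R]_n -> 'M[R]_(n + n) -> \bar R)
    (x : 'cV[R]_n) (Z : 'M[R]_(n + n)) (u : 'cV[R]_m) : \bar R :=
  ereal_sup (range (fun v : 'cV[R]_n =>
    ((qnorm Q x + qnorm S u)%:E + V v (Z + datum x u v)%R)%E)).

Definition bellman (V : 'cV[R]_n -> 'M[R]_(n + n) -> \bar R)
    (x : 'cV[R]_n) (Z : 'M[R]_(n + n)) : \bar R :=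
  ereal_inf (range (bellman_obj V x Z)).

(* Total in Z; only positive semidefinite Z are meaningful, and [bellman]
   evaluates its argument at such matrices only when Z is one. *)
Fixpoint Viter (k : nat) : 'cV[R]_n -> 'M[R]_(n + n) -> \bar R :=
  if k is k'.+1 then bellman (Viter k')
  else fun _ Z => (- (gamma ^+ 2 * min_sign_norm Z))%:E.

(* The minimizing u need not be unique a priori: eta is any selection. *)
Definition minimizing_law (V : 'cV[R]_n -> 'M[R]_(n + n) -> \bar R)
    (eta : state_law) : Prop :=
  forall x Z, possemidef Z -> bellman_obj V x Z (eta x Z) = bellman V x Z.

Definition law_of_state_law (eta : state_law) : history_law :=
  fun t (x : 'I_t.+1 -> 'cV[R]_n) (u : 'I_t -> 'cV[R]_m) =>
    eta (x ord_max)
        (\sum_(tau < t)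
           datum (x (widen_ord (leqnSn t) tau)) (u tau) (x (lift ord0 tau))).

End Game.

(* Main.v *)
Require Import Defs.
From mathcomp Require Import lra.
Set Implicit Arguments.
Unset Strict Implicit.
Unset Printing Implicit Defensive.
Import Order.TTheory GRing.Theory Num.Theory.
Import numFieldNormedType.Exports.
Local Open Scope classical_set_scope.
Local Open Scope ring_scope.

(** The two games are the same game.  In Problem I, once the sign i is fixed,
    the disturbance w is determined by the trajectory, and the penalty
    gamma^2 sum |w_t|^2 equals gamma^2 times the value at the data matrix Z of
    the linear form q_i(Z) = ||[I iA]^T||^2_Z ([sign_norm]).  Maximizing over i
    turns this into - gamma^2 min_i q_i(Z), the terminal cost of Problem II.

    The matrix Z enters the V_k only through the two numbers q_1(Z) and
    q_(-1)(Z), and V_k is nonexpansive in them up to the factor gamma^2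
    ([Viter_nonexpansive]), because V_0 is and the Bellman operator preserves
    this.  Hence a bound on V_k(x,0) gives one on V_k(x,Z).  The adversary may
    always play the disturbance that is consistent with the more favourable
    sign; this gives V_0 <= V_1, so the V_k increase, and it shows that the
    Bellman objective dominates |u|_S^2 up to a constant.  A bounded sequence
    therefore has a finite limit V_*.

    The delicate point is F V_* = V_*, an exchange of inf_u with sup_k.  The
    objectives increase with k, their sublevel sets in u are closed (they are
    suprema over v of functions continuous in u) and, S being positive
    definite, bounded; compactness then yields a single u that is good for all
    k ([inf_nondecreasing_attained]).  The same u attains the minimum in F V_*.

    Any history-dependent law can be made to pay almost V_k(x_0,0), by an
    adversary that follows the nested suprema in V_k ([adversary]).  Conversely,
    along a trajectory of a law minimizing F V_*, the running cost plus V_* does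
    not increase, so that law pays at most V_* ([cost2_le_Vlim]).  Since a state
    law, read as a history law, costs no more in Problem I than in Problem II
    ([cost1_law_le_cost2]), we get
      V_* <= value of Problem I <= value of Problem II <= V_*. *)

(** * Minimizers of increasing sequences of coercive functions *)

Section Compactness.
Context {R : realType}.

Lemma trmx_continuous (p q : nat) :
  continuous (fun M : 'M[R]_(p, q) => M^T).
Proof.
move=> M U /= /(nbhs_ballP (M^T)) [e e0 eU].
apply/nbhs_ballP; exists e => //= N [e1 MN]; apply: eU; split => // i j.
by rewrite !mxE; exact: MN.
Qed.

Lemma continuous_sum (T : topologicalType) (p : nat) (F : 'I_p -> T -> R) :
  (forall i, continuous (F i)) -> continuous (fun x => \sum_(i < p) F i x).
Proof.
move=> cF; apply: continuous_big => [|i _]; last exact: cF.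
exact: add_continuous.
Qed.

Lemma continuous_mul (T : topologicalType) (f g : T -> R) :
  continuous f -> continuous g -> continuous (fun x => f x * g x).
Proof. by move=> cf cg x; apply: cvgM; [exact: cf|exact: cg]. Qed.

Lemma continuous_add (T : topologicalType) (f g : T -> R) :
  continuous f -> continuous g -> continuous (fun x => f x + g x).
Proof. by move=> cf cg x; apply: cvgD; [exact: cf|exact: cg]. Qed.

Lemma coord_mulmx_continuous (p q r : nat) (N : 'M[R]_(p, q)) i j :
  continuous (fun u : 'M[R]_(q, r) => (N *m u) i j).
Proof.
rewrite (_ : (fun _ => _) = fun u : 'M[R]_(q, r) => \sum_k N i k * u k j);
  last first.
  by apply/funext => u; rewrite mxE.
apply: continuous_sum => k; apply: continuous_mul.
  exact: cst_continuous.
exact: coord_continuous.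
Qed.

Lemma qnorm_continuous (p : nat) (M : 'M[R]_p) : continuous (qnorm M).
Proof.
rewrite (_ : qnorm M = fun u : 'cV_p =>
    \sum_k u k ord0 * (M *m u) k ord0); last first.
  apply/funext => u; rewrite /qnorm -mulmxA mxE.
  by apply: eq_bigr => k _; rewrite !mxE.
apply: continuous_sum => k.
apply: continuous_mul; [exact: coord_continuous|exact: coord_mulmx_continuous].
Qed.

Lemma sqnormE (p : nat) (x : 'cV[R]_p) : sqnorm x = \sum_k x k ord0 ^+ 2.
Proof.
by rewrite /sqnorm mxE; apply: eq_bigr => k _; rewrite mxE expr2.
Qed.

Lemma sqnorm_affine_continuous (p q : nat) (N : 'M[R]_(p, q)) (d : 'cV[R]_p) :
  continuous (fun u => sqnorm (N *m u + d)).
Proof.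
rewrite (_ : (fun _ => _) = fun u : 'cV_q =>
    \sum_k ((N *m u) k ord0 + d k ord0) * ((N *m u) k ord0 + d k ord0));
  last first.
  apply/funext => u; rewrite sqnormE.
  by apply: eq_bigr => k _; rewrite !mxE expr2.
apply: continuous_sum => k.
have cNd : continuous (fun u : 'cV_q => (N *m u) k ord0 + d k ord0).
  apply: continuous_add; last exact: cst_continuous.
  exact: coord_mulmx_continuous.
exact: continuous_mul.
Qed.

(** Bolzano-Weierstrass: the transposes stay in a compact box of row vectors. *)
Lemma bounded_seq_cluster (p : nat) (u : nat -> 'cV[R]_p) (M : R) :
  (forall k i, `|u k i ord0| <= M) ->
  exists a : 'cV[R]_p, forall N (U : set 'cV[R]_p), nbhs a U ->
    exists2 k, (N <= k)%N & U (u k).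
Proof.
move=> uM.
pose K := [set y : 'rV[R]_p | forall i, y ord0 i \in `[(- M), M]].
have cK : compact K.
  apply: (@rV_compact _  _ (fun=> `[(- M), M]%classic)) => _.
  exact: segment_compact.
have [|a [_ aP]] := cK ((fun k => (u k)^T) @ \oo) _.
  by exists 0%N => // k _ i /=; rewrite !mxE in_itv /= -ler_norml.
exists (a^T) => N U aU.
have aU' : nbhs a ((fun y : 'rV[R]_p => y^T) @^-1` U) by exact: trmx_continuous.
have [y [[k Nk <-] Uy]] : (fun k => (u k)^T) @` [set k | (N <= k)%N] `&`
    ((fun y : 'rV[R]_p => y^T) @^-1` U) !=set0.
  apply: aP => //; exists N => // k Nk; exists k => //.
by exists k => //; rewrite -(trmxK (u k)).
Qed.

(** An exchange of infimum and supremum over k.  Near-minimizers u_k of h_k,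
    with a tolerance tending to 0, stay in a bounded sublevel set of h_0.  For
    fixed j and large k, the monotonicity in k puts u_k in a sublevel set of
    h_j just above c; these sets being closed, a cluster point of the u_k
    serves for every j. *)
Lemma inf_nondecreasing_attained (p : nat) (h : nat -> 'cV[R]_p -> \bar R)
    (c : R) :
  (forall j k u, (j <= k)%N -> (h j u <= h k u)%E) ->
  (forall k (d : R), closed [set u | (h k u <= d%:E)%E]) ->
  (forall d : R, exists M : R, forall u, (h 0%N u <= d%:E)%E ->
     forall i, `|u i ord0| <= M) ->
  (forall k, (ereal_inf (range (h k)) <= c%:E)%E) ->
  exists u, forall k, (h k u <= c%:E)%E.
Proof.
move=> hnd hcl hco hc.
have /choice[u uP] : forall k, exists u, (h k u <= (c + k.+1%:R^-1)%:E)%E.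
  move=> k; have /ereal_inf_ltP[_ [u _ <-] uc] :
      (ereal_inf (range (h k)) < (c + k.+1%:R^-1)%:E)%E.
    by apply: le_lt_trans (hc k) _; rewrite lte_fin ltrDl invr_gt0.
  by exists u; exact: ltW.
have [M MP] := hco (c + 1).
have [|a aP] := @bounded_seq_cluster p u M.
  move=> k; apply: MP; apply: le_trans (hnd 0%N k _ _) _ => //.
  apply: le_trans (uP k) _; rewrite lee_fin lerD2l invf_le1 ?ltr0n //.
  by rewrite ler1n.
exists a => j.
have small (e : R) : 0 < e -> (h j a <= (c + e)%:E)%E.
  move=> e0; apply: (hcl j (c + e)) => U /aP aU.
  have [k kP Uk] := aU (maxn j (Num.trunc e^-1)).
  exists (u k); split => //=.
  move: kP; rewrite geq_max => /andP[jk ek].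
  apply: le_trans (hnd _ _ _ jk) _; apply: le_trans (uP k) _.
  rewrite lee_fin lerD2l -[leRHS]invrK lef_pV2 ?posrE ?invr_gt0 ?ltr0n //.
  have := @truncnS_gt R e^-1; move=> /ltW/le_trans; apply.
  by rewrite ler_nat ltnS.
apply/lee_addgt0Pr => e e0; rewrite -EFinD; exact: small.
Qed.

Lemma coord_le_norm (p q : nat) (N : 'M[R]_(p, q)) i j : `|N i j| <= `|N|.
Proof.
rewrite [leRHS]/Num.norm /= mx_normrE; apply/bigmax_geP; right => /=.
by exists (i, j).
Qed.

(** On the compact unit sphere the form has a positive minimum, and it is
    homogeneous of degree 2. *)
Lemma posdef_coercive (p : nat) (M : 'M[R]_p) : posdef M ->
  forall d : R, exists C : R, forall u, qnorm M u <= d ->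
    forall i, `|u i ord0| <= C.
Proof.
move=> [_ Mpos] d.
pose K := [set y : 'rV[R]_p | `|y^T| = 1].
have trC : continuous (fun y : 'rV[R]_p => y^T) by exact: trmx_continuous.
have cK : compact K.
  apply: bounded_closed_compact.
    exists 1; split => // x x1 y /= y1.
    apply: le_trans (ltW x1); rewrite -y1.
    by rewrite [leLHS]/Num.norm /= mx_normrE; apply: bigmax_le => // -[i j] _ /=;
       have := coord_le_norm y^T j i; rewrite mxE.
  apply: (@closed_comp _ _ (fun y : 'rV[R]_p => `|y^T|) [set 1]).
    by move=> y _; apply: continuous_comp; [exact: trC|exact: norm_continuous].
  exact: closed_eq.
have [c c0 cP] : exists2 c : R, 0 < c & forall y, `|y| = 1 -> c <= qnorm M y.
  have [K0|/set0P/negP] := pselect (K !=set0); last first.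
    rewrite negbK => /eqP K0; exists 1 => // y y1.
    by have : K y^T; [rewrite /K /= trmxK|rewrite K0].
  have [|a /[!inE] aK aP] :=
      @EVT_min_rV _ _ (fun y : 'rV[R]_p => qnorm M y^T) _ K0 cK.
    apply: continuous_subspaceT => y.
    by apply: continuous_comp; [exact: trC|exact: qnorm_continuous].
  exists (qnorm M a^T); first apply: Mpos.
    by rewrite -normr_eq0 aK oner_eq0.
  by move=> y y1; rewrite -(trmxK y); apply: aP; rewrite inE /K /= trmxK.
exists (1 + `|d| / c) => u ud i; apply: le_trans (coord_le_norm _ _ _) _.
have [->|u0] := eqVneq `|u| 0; first by rewrite addr_ge0 // divr_ge0 // ltW.
have nu0 : 0 < `|u| by rewrite lt_def u0 /=.
have : c * `|u| ^+ 2 <= `|d|.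
  apply: le_trans (le_trans ud (ler_norm d)).
  have -> : qnorm M u = qnorm M (`|u|^-1 *: u) * `|u| ^+ 2.
    rewrite /qnorm [(_ *: _)^T]linearZ /= -!scalemxAl -scalemxAr.
    rewrite scalerA; move: (_ *m u) => T.
    rewrite [X in _ = X * _]mxE -invfM -expr2.
    by rewrite mulrAC mulVf ?mul1r // sqrf_eq0.
  rewrite ler_pM2r ?exprn_gt0 //; apply: cP.
  by rewrite normrZ normfV normr_id mulVf.
(* t <= 1 + t ^+ 2 avoids taking a square root. *)
rewrite mulrC -ler_pdivlMr // => h; have := sqr_ge0 (`|u| - 1); nra.
Qed.

End Compactness.

(** * The data matrix seen through the two signs *)

Section SignNorm.
Context {R : realType} {n m : nat}.
Variables (A : 'M[R]_n) (B : 'M[R]_(n, m)).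

Definition sign_norm (i : R) (Z : 'M[R]_(n + n)) : R :=
  mxqnorm Z (row_mx 1%:M (i *: A))^T.

Lemma sign_normD i Z Z' :
  sign_norm i (Z + Z') = sign_norm i Z + sign_norm i Z'.
Proof. by rewrite /sign_norm /mxqnorm mulmxDr mulmxDl linearD. Qed.

Lemma sign_norm0 i : sign_norm i 0 = 0.
Proof. by rewrite /sign_norm /mxqnorm mulmx0 mul0mx linear0. Qed.

(** The datum of a transition penalizes exactly the disturbance that explains
    it under the sign i. *)
Lemma sign_norm_datum i x u v :
  sign_norm i (datum B x u v) = sqnorm (B *m u - v + (i *: A) *m x).
Proof.
rewrite /sign_norm /mxqnorm /datum trmxK mulmxA -mulmxA.
rewrite mxtrace_mulC -trmx_mul.
rewrite mul_row_col mul1mx.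
by rewrite /mxtrace big_ord1 /sqnorm.
Qed.

Lemma min_sign_norm_le i Z : i = 1 \/ i = -1 ->
  min_sign_norm A Z <= sign_norm i Z.
Proof. by case=> ->; rewrite /min_sign_norm ge_min lexx ?orbT. Qed.

Lemma min_sign_norm_attained Z : exists2 i : R,
  i = 1 \/ i = -1 & min_sign_norm A Z = sign_norm i Z.
Proof.
rewrite /min_sign_norm; case: leP => _; [exists 1|exists (-1)] => //.
  by left.
by right.
Qed.

Lemma sqnormN (p : nat) (x : 'cV[R]_p) : sqnorm (- x) = sqnorm x.
Proof. by rewrite !sqnormE; apply: eq_bigr => k _; rewrite mxE sqrrN. Qed.

Lemma sqnorm_ge0 (p : nat) (x : 'cV[R]_p) : 0 <= sqnorm x.
Proof. by rewrite sqnormE; apply: sumr_ge0 => k _; exact: sqr_ge0. Qed.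

Lemma sqnorm0 (p : nat) : sqnorm (0 : 'cV[R]_p) = 0.
Proof. by rewrite /sqnorm mulmx0 mxE. Qed.

Lemma posdef_ge0 (p : nat) (M : 'M[R]_p) x : posdef M -> 0 <= qnorm M x.
Proof.
move=> [_ M0]; have [->|/M0/ltW//] := eqVneq x 0.
by rewrite /qnorm mulmx0 mxE.
Qed.

Lemma possemidef0 (p : nat) : possemidef (0 : 'M[R]_p).
Proof.
by split => [|x]; [rewrite linear0|rewrite /qnorm mulmx0 mul0mx mxE].
Qed.

Lemma possemidef_datum Z x u v :
  possemidef Z -> possemidef (Z + datum B x u v).
Proof.
move=> [Zt Z0]; split; first by rewrite linearD /= Zt /datum trmx_mul trmxK.
move=> y; rewrite /qnorm mulmxDr mulmxDl mxE addr_ge0 //; first exact: Z0.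
rewrite /datum; set d := col_mx _ _.
have -> : y^T *m (d *m d^T) *m y = (d^T *m y)^T *m (d^T *m y).
  by rewrite trmx_mul trmxK !mulmxA.
exact: sqnorm_ge0.
Qed.

End SignNorm.

(** * The value iteration *)

Section Bellman.
Context {R : realType} {n m : nat}.
Variables (A : 'M[R]_n) (B : 'M[R]_(n, m)) (Q : 'M[R]_n) (S : 'M[R]_m).
Variable gamma : R.
Hypotheses (hQ : posdef Q) (hS : posdef S).
Local Notation V := (Viter A B Q S gamma).
Local Notation q := (sign_norm A).
Implicit Types (W : 'cV[R]_n -> 'M[R]_(n + n) -> \bar R) (x v : 'cV[R]_n).
Implicit Types (Z : 'M[R]_(n + n)) (u : 'cV[R]_m).

Lemma bellman_obj_le W x Z u c :
  (forall v, ((qnorm Q x + qnorm S u)%:E + W v (Z + datum B x u v)%R <= c)%E) <->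
  (bellman_obj B Q S W x Z u <= c)%E.
Proof.
split=> [h|/ereal_supP h v]; last by apply: h; exists v.
by apply/ereal_supP => _ [v _ <-].
Qed.

Lemma le_bellman_obj W W' x Z u :
  (forall v Z, (W v Z <= W' v Z)%E) ->
  (bellman_obj B Q S W x Z u <= bellman_obj B Q S W' x Z u)%E.
Proof.
move=> WW'; apply/bellman_obj_le => v.
apply: le_trans (leeD2l _ (WW' _ _)) _.
by apply: ereal_sup_ubound; exists v.
Qed.

Lemma le_bellman W W' x Z :
  (forall v Z, (W v Z <= W' v Z)%E) ->
  (bellman B Q S W x Z <= bellman B Q S W' x Z)%E.
Proof.
move=> WW'; apply/ereal_infP => _ [u _ <-].
apply: le_trans (le_bellman_obj _ _ _ WW').
by apply: ereal_inf_lbound; exists u.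
Qed.

(** The adversary plays v = Bu + iAx for the sign i minimizing q_i(Z): the new
    datum then leaves q_i unchanged, so the penalty does not grow. *)
Lemma bellman_obj_ge W x Z u : (forall v Z, (V 0%N v Z <= W v Z)%E) ->
  ((qnorm Q x + qnorm S u)%:E + V 0%N x Z <= bellman_obj B Q S W x Z u)%E.
Proof.
move=> W0; have [i i1 iZ] := min_sign_norm_attained A Z.
pose v := B *m u + (i *: A) *m x.
apply: (@le_trans _ _
    ((qnorm Q x + qnorm S u)%:E + W v (Z + datum B x u v)%R)%E); last first.
  by apply: ereal_sup_ubound; exists v.
apply: leeD2l; apply: le_trans (W0 _ _).
rewrite lee_fin lerN2 iZ ler_wpM2l ?sqr_ge0 //.
apply: le_trans (min_sign_norm_le _ _ i1) _.
rewrite sign_normD sign_norm_datum /v opprD addrA subrr add0r addNr sqnorm0.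
by rewrite addr0.
Qed.

Lemma Viter_leS k x Z : (V k x Z <= V k.+1 x Z)%E.
Proof.
elim: k x Z => [|k IH] x Z; last exact: le_bellman.
apply/ereal_infP => _ [u _ <-]; apply: le_trans (bellman_obj_ge _ _ _ _) => //.
by rewrite leeDr // lee_fin addr_ge0 // posdef_ge0.
Qed.

Lemma Viter_nondecreasing x Z : nondecreasing_seq (fun k => V k x Z).
Proof. by apply/nondecreasing_seqP => k; exact: Viter_leS. Qed.

Lemma Viter_ge0 k x Z : (V 0%N x Z <= V k x Z)%E.
Proof. exact: (@Viter_nondecreasing x Z 0%N k). Qed.

(** With e = 0 this says that V_k decreases in Z; with general e it is the
    Lipschitz estimate.  The hypothesis is stable under adding the same datum to
    Z and Z', which makes the induction go through inf and sup. *)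
Lemma Viter_nonexpansive k x Z Z' (e : R) :
  (forall i, i = 1 \/ i = -1 -> q i Z' <= q i Z + e) ->
  (V k x Z <= V k x Z' + (gamma ^+ 2 * e)%:E)%E.
Proof.
elim: k x Z Z' => [|k IH] x Z Z' ZZ'.
  have [i i1 iZ] := min_sign_norm_attained A Z.
  rewrite /= -EFinD lee_fin iZ lerNl opprD opprK -mulrBr ler_wpM2l ?sqr_ge0 //.
  by rewrite lerBlDr; apply: le_trans (ZZ' i i1); exact: min_sign_norm_le.
rewrite -leeBlDr //; apply/ereal_infP => _ [u _ <-]; rewrite leeBlDr //.
apply: (@le_trans _ _ (bellman_obj B Q S (V k) x Z u)).
  by apply: ereal_inf_lbound; exists u.
apply/bellman_obj_le => v.
apply: (@le_trans _ _ ((qnorm Q x + qnorm S u)%:E +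
    (V k v (Z' + datum B x u v)%R + (gamma ^+ 2 * e)%:E))%E).
  by apply: leeD2l; apply: IH => i i1; rewrite !sign_normD addrAC lerD2r ZZ'.
rewrite addeA leeD2r //; apply: ereal_sup_ubound; by exists v.
Qed.

Hypothesis Vbounded : forall x, exists M : R, forall k, (V k x 0 <= M%:E)%E.

Lemma Viter_bounded x Z : exists M : R, forall k, (V k x Z <= M%:E)%E.
Proof.
have [M MP] := Vbounded x.
pose e := `|q 1 Z| + `|q (-1) Z|.
exists (M + gamma ^+ 2 * e) => k; rewrite EFinD.
apply: le_trans (leeD2r _ (MP k)); apply: Viter_nonexpansive => i i1.
rewrite sign_norm0 -lerBlDl sub0r.
apply: le_trans (ler_norm _) _; rewrite normrN /e.
by case: i1 => ->; rewrite ?lerDl ?lerDr.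
Qed.

Definition Vlim x Z : R := fine (ereal_sup (range (fun k => V k x Z))).

Lemma VlimE x Z : (Vlim x Z)%:E = ereal_sup (range (fun k => V k x Z)).
Proof.
have [M MP] := Viter_bounded x Z; rewrite /Vlim fineK // fin_real //.
apply/andP; split.
  apply: (@lt_le_trans _ _ (V 0%N x Z)); first by rewrite ltNyr.
  by apply: ereal_sup_ubound; exists 0%N.
apply: (@le_lt_trans _ _ M%:E); last by rewrite ltry.
by apply/ereal_supP => _ [k _ <-].
Qed.

Lemma Viter_le_Vlim k x Z : (V k x Z <= (Vlim x Z)%:E)%E.
Proof. by rewrite VlimE; apply: ereal_sup_ubound; exists k. Qed.

Lemma Viter_cvg x Z : (fun k => V k x Z) @ \oo --> (Vlim x Z)%:E.
Proof.
by rewrite VlimE; apply: ereal_nondecreasing_cvgn; exact: Viter_nondecreasing.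
Qed.

Lemma Viter_fin_num k x Z : V k x Z \is a fin_num.
Proof.
rewrite fin_real //; apply/andP; split.
  by apply: lt_le_trans (Viter_ge0 k x Z); rewrite ltNyr.
by apply: le_lt_trans (Viter_le_Vlim k x Z) _; rewrite ltry.
Qed.

Lemma Viter_dist k x Z Z' (e : R) :
  (forall i, i = 1 \/ i = -1 -> `|q i Z - q i Z'| <= e) ->
  `|fine (V k x Z) - fine (V k x Z')| <= gamma ^+ 2 * e.
Proof.
move=> ZZ'.
have le (Y Y' : 'M[R]_(n + n)) :
    (forall i, i = 1 \/ i = -1 -> `|q i Y - q i Y'| <= e) ->
    fine (V k x Y) <= fine (V k x Y') + gamma ^+ 2 * e.
  move=> YY'; rewrite -lee_fin EFinD !fineK ?Viter_fin_num //.
  apply: Viter_nonexpansive => i /YY'; rewrite distrC => /(le_trans (ler_norm _)).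
  by rewrite lerBlDl.
have := le Z Z' ZZ'; have := le Z' Z.
rewrite ler_norml lerBlDl lerBrDl => h ->; rewrite andbT lerBlDr.
by apply: h => i i1; rewrite distrC ZZ'.
Qed.

Lemma Viter_input_continuous k v x Z :
  continuous (fun u => fine (V k v (Z + datum B x u v))).
Proof.
move=> u; apply/(@cvgrPdist_le _ _ _ _ (nbhs_filter u)) => e e0.
have d0 : 0 < e / (gamma ^+ 2 + 1).
  by rewrite divr_gt0 // ltr_wpDl // sqr_ge0.
have qC i : continuous (fun u => q i (Z + datum B x u v)).
  rewrite (_ : (fun _ => _) = fun u : 'cV_m =>
      q i Z + sqnorm (B *m u + (- v + (i *: A) *m x))); last first.
    by apply/funext => w; rewrite sign_normD sign_norm_datum addrA.
  apply: continuous_add; first exact: cst_continuous.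
  exact: sqnorm_affine_continuous.
have near1 := (@cvgrPdist_le _ _ _ _ (nbhs_filter u) _ _).1 (qC 1 u) _ d0.
have near2 := (@cvgrPdist_le _ _ _ _ (nbhs_filter u) _ _).1 (qC (-1) u) _ d0.
near=> u'.
apply: le_trans (_ : gamma ^+ 2 * (e / (gamma ^+ 2 + 1)) <= _).
  by apply: Viter_dist => i [->|->]; near: u'.
rewrite mulrCA ler_piMr ?(ltW e0) // ler_pdivrMr ?mul1r ?lerDl //.
by rewrite ltr_wpDl // sqr_ge0.
Unshelve. all: by end_near. Qed.

(** Lower semicontinuity in u: the sublevel set is an intersection over v of
    sublevel sets of continuous functions. *)
Lemma closed_bellman_obj_sublevel k x Z (d : R) :
  closed [set u | (bellman_obj B Q S (V k) x Z u <= d%:E)%E].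
Proof.
pose g v u := qnorm Q x + qnorm S u + fine (V k v (Z + datum B x u v)).
have -> : [set u | (bellman_obj B Q S (V k) x Z u <= d%:E)%E] =
    \bigcap_(v in setT) (g v @^-1` [set y | y <= d]).
  have gE v u : (g v u <= d) = ((qnorm Q x + qnorm S u)%:E +
      V k v (Z + datum B x u v)%R <= d%:E)%E.
    by rewrite -lee_fin EFinD fineK // Viter_fin_num.
  apply/seteqP; split => u /= h.
    by move=> v _; rewrite /= gE; move: v; apply/bellman_obj_le.
  by apply/bellman_obj_le => v; rewrite -gE; exact: h.
apply: closed_bigI => v _; apply: closed_comp; last exact: closed_le.
move=> u _; apply: continuous_add; last exact: Viter_input_continuous.
apply: continuous_add; [exact: cst_continuous|exact: qnorm_continuous].
Qed.

(** The input that compactness provides is good for all k, hence for the limit;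
    this gives both F V_* <= V_* and the existence of a minimizing law. *)
Lemma bellman_Vlim_attained x Z :
  exists u, (bellman_obj B Q S (fun x Z => (Vlim x Z)%:E) x Z u
             <= (Vlim x Z)%:E)%E.
Proof.
have [||||u uP] := @inf_nondecreasing_attained R m
    (fun k u => bellman_obj B Q S (V k) x Z u) (Vlim x Z).
- move=> j k u jk; apply: le_bellman_obj => v Z'; exact: Viter_nondecreasing.
- by move=> k d; exact: closed_bellman_obj_sublevel.
- move=> d; have [C CP] := posdef_coercive hS
    (d - qnorm Q x + gamma ^+ 2 * min_sign_norm A Z).
  exists C => u ud; apply: CP.
  have /le_trans/(_ ud) := @bellman_obj_ge (V 0%N) x Z u (fun _ _ => lexx _).
  by rewrite /= -EFinD lee_fin => h; lra.
- by move=> k; exact: (Viter_le_Vlim k.+1 x Z).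
exists u; apply/bellman_obj_le => v.
rewrite -leeBrDl // VlimE; apply/ereal_supP => _ [k _ <-].
rewrite leeBrDl //; move: v; apply/bellman_obj_le; exact: uP.
Qed.

Lemma bellman_Vlim x Z :
  bellman B Q S (fun x Z => (Vlim x Z)%:E) x Z = (Vlim x Z)%:E.
Proof.
apply/eqP; rewrite eq_le; apply/andP; split.
  have [u uP] := bellman_Vlim_attained x Z.
  by apply: le_trans uP; apply: ereal_inf_lbound; exists u.
rewrite {1}VlimE; apply/ereal_supP => _ [k _ <-].
apply: le_trans (Viter_leS k x Z) _; apply: le_bellman => v Z'.
exact: Viter_le_Vlim.
Qed.

End Bellman.

(** * Closed-loop inputs of a history law *)

Section Inputs.
Context {R : realType} {n m : nat}.
Variable mu : @history_law R n m.
Implicit Types x : nat -> 'cV[R]_n.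

(** The law wants its past inputs as a function on an ordinal, which is not
    available before they have all been computed; the recursion accumulates them
    in a list instead. *)
Fixpoint past_inputs x t : seq 'cV[R]_m :=
  if t is t'.+1 then
    rcons (past_inputs x t')
      (mu (fun s : 'I_t'.+1 => x s) (fun s : 'I_t' => nth 0 (past_inputs x t') s))
  else [::].

Definition inputs x t : 'cV[R]_m :=
  mu (fun s : 'I_t.+1 => x s) (fun s : 'I_t => nth 0 (past_inputs x t) s).

Lemma past_inputsE x t : past_inputs x t = mkseq (inputs x) t.
Proof. by elim: t => //= t IH; rewrite mkseqS -IH. Qed.

Lemma inputsE x t :
  inputs x t = mu (fun s : 'I_t.+1 => x s) (fun s : 'I_t => inputs x s).
Proof.
rewrite {1}/inputs; congr mu; apply/funext => s.
by rewrite past_inputsE nth_mkseq.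
Qed.

Lemma inputs_causal x y t : (forall s, (s <= t)%N -> x s = y s) ->
  inputs x t = inputs y t.
Proof.
elim/ltn_ind: t => t IH xy; rewrite !inputsE; congr mu; apply/funext => s.
  by apply: xy; rewrite -ltnS.
by apply: IH => // r rs; apply: xy; exact: leq_trans rs (ltnW _).
Qed.

End Inputs.

(** * Lower and upper bounds on the costs *)

Section Game.
Context {R : realType} {n m : nat}.
Variables (A : 'M[R]_n) (B : 'M[R]_(n, m)) (Q : 'M[R]_n) (S : 'M[R]_m).
Variable gamma : R.
Hypotheses (hQ : posdef Q) (hS : posdef S).
Local Notation V := (Viter A B Q S gamma).
Local Notation q := (sign_norm A).
Implicit Types (x : nat -> 'cV[R]_n) (u : nat -> 'cV[R]_m).

Definition data x u t : 'M[R]_(n + n) :=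
  \sum_(s < t) datum B (x s) (u s) (x s.+1).

Lemma dataS x u t : data x u t.+1 = data x u t + datum B (x t) (u t) (x t.+1).
Proof. by rewrite /data big_ord_recr. Qed.

(** The common payoff of both games over N stages, for the more favourable sign
    in Problem I. *)
Definition payoff x u N : R :=
  \sum_(0 <= t < N) (qnorm Q (x t) + qnorm S (u t))
  - gamma ^+ 2 * min_sign_norm A (data x u N).

Lemma sign_norm_data x u i N :
  \sum_(t < N) sqnorm (x t.+1 - ((i *: A) *m x t + B *m u t)) =
  q i (data x u N).
Proof.
elim: N => [|N IH]; first by rewrite big_ord0 /data big_ord0 sign_norm0.
rewrite big_ord_recr IH dataS sign_normD sign_norm_datum; congr (_ + _).
by rewrite -sqnormN opprB [_ + B *m _]addrC addrAC.
Qed.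

Lemma disturbance_cost x u w i N :
  (forall t, x t.+1 = (i *: A) *m x t + B *m u t + w t) ->
  \sum_(t < N) (qnorm Q (x t) + qnorm S (u t) - gamma ^+ 2 * sqnorm (w t)) =
  \sum_(0 <= t < N) (qnorm Q (x t) + qnorm S (u t))
    - gamma ^+ 2 * q i (data x u N).
Proof.
move=> xE; rewrite sumrB -mulr_sumr big_mkord; congr (_ - _ * _).
rewrite -sign_norm_data; apply: eq_bigr => t _.
by rewrite xE addrAC subrr add0r.
Qed.

Lemma payoff_le_cost1 mu x N :
  ((payoff x (inputs mu x) N.+1)%:E <= cost1 A B Q S gamma mu (x 0%N))%E.
Proof.
have [i i1 iE] := min_sign_norm_attained A (data x (inputs mu x) N.+1).
pose w t := x t.+1 - ((i *: A) *m x t + B *m inputs mu x t).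
have xE t : x t.+1 = (i *: A) *m x t + B *m inputs mu x t + w t.
  by rewrite addrC subrK.
apply: ereal_sup_ubound; exists w, i, N, x, (inputs mu x); split => //.
  by split => // t; exact: inputsE.
by rewrite (disturbance_cost _ xE) -iE.
Qed.

(** The law mu is arbitrary, so the adversary is built forwards along the
    trajectory: at each stage V_(k+1) is at most the Bellman objective at the
    input that mu has chosen, and some v comes close to the supremum there.
    Extending the trajectory by v does not change the inputs already played,
    since they depend on the past only.  The strict inequality leaves the room
    needed when the suprema are not attained, or are infinite. *)
Lemma adversary mu k t x (c : R) :
  (c%:E < V k (x t) (data x (inputs mu x) t))%E ->
  exists y, (forall s, (s <= t)%N -> y s = x s) /\
    c < payoff y (inputs mu y) (t + k)
        - \sum_(0 <= s < t) (qnorm Q (y s) + qnorm S (inputs mu y s)).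
Proof.
elim: k t x c => [|k IH] t x c /=.
  rewrite lte_fin => h; exists x; split => //.
  by rewrite addn0 /payoff addrAC subrr add0r.
move=> /lt_le_trans h.
have /h/ereal_sup_gtP[_ [v _ <-]] :
    (bellman B Q S (V k) (x t) (data x (inputs mu x) t) <=
     bellman_obj B Q S (V k) (x t) (data x (inputs mu x) t) (inputs mu x t))%E.
  by apply: ereal_inf_lbound; exists (inputs mu x t).
rewrite -lteBlDl // -EFinB => {h}.
pose x' s := if (s <= t)%N then x s else v.
have x'x s : (s <= t)%N -> x' s = x s by rewrite /x' => ->.
have x'v : x' t.+1 = v by rewrite /x' ltnn.
have ux' s : (s <= t)%N -> inputs mu x' s = inputs mu x s.
  by move=> st; apply: inputs_causal => r rs; exact: x'x (leq_trans rs st).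
have -> : data x (inputs mu x) t + datum B (x t) (inputs mu x t) v =
    data x' (inputs mu x') t.+1.
  rewrite dataS x'v x'x // ux' //; congr (_ + _).
  apply: eq_bigr => s _; have st := ltn_ord s.
  by rewrite !x'x ?ux' // ltnW.
rewrite -x'v => /IH[y [yx' yc]]; exists y; split.
  by move=> s st; rewrite yx' ?x'x // ltnW.
have yx : y t = x t by rewrite yx' // x'x.
have uyx : inputs mu y t = inputs mu x t.
  by rewrite -ux' //; apply: inputs_causal => s st; rewrite yx' // ltnW.
rewrite big_nat_recr //= yx uyx in yc.
rewrite addnS -addSn; lra.
Qed.

Lemma Viter_le_cost1 mu k (x0 : 'cV[R]_n) :
  (V k x0 0%R <= cost1 A B Q S gamma mu x0)%E.
Proof.
apply: le_trans (Viter_leS A B gamma hQ hS k x0 0) _; rewrite leNgt; apply/negP.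
have above : forall c : R, (c%:E < V k.+1 x0 0)%E ->
    exists2 d : R, c < d & (d%:E <= cost1 A B Q S gamma mu x0)%E.
  move=> c cV.
  have [|y [y0]] := @adversary mu k.+1 0 (fun=> x0) c.
    by rewrite /data big_ord0.
  rewrite big_geq // subr0 add0n => yc.
  exists (payoff y (inputs mu y) k.+1) => //.
  by rewrite -[x0](y0 0%N) //; exact: payoff_le_cost1.
have := payoff_le_cost1 mu (fun=> x0) 0%N.
case: (cost1 _ _ _ _ _ _ _) above => [r above _ /above[d rd]| _ _|//].
  by rewrite lee_fin leNgt rd.
by rewrite ltNge leey.
Qed.

(** The sign chosen in Problem I may be the less favourable one for the
    adversary, whereas Problem II always charges the smaller penalty. *)
Lemma cost1_law_le_cost2 eta (x0 : 'cV[R]_n) :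
  (cost1 A B Q S gamma (law_of_state_law B eta) x0 <=
   cost2 A B Q S gamma eta x0)%E.
Proof.
apply/ereal_supP => _ [w [i [N [x [u [i1 [x00 xE uE] ->]]]]]].
apply: (@le_trans _ _ (payoff x u N.+1)%:E).
  rewrite lee_fin (disturbance_cost _ xE) lerD2l lerN2 ler_wpM2l ?sqr_ge0 //.
  exact: min_sign_norm_le.
apply: ereal_sup_ubound; exists (fun t => x t.+1), N, x, u, (data x u).
rewrite /payoff big_mkord; split => //; split => //.
- by rewrite /data big_ord0.
- by move=> t; rewrite dataS.
Qed.

Hypothesis Vbounded : forall x : 'cV[R]_n,
  exists M : R, forall k, (V k x 0 <= M%:E)%E.
Local Notation Vlim := (Vlim A B Q S gamma).

(** The running cost plus V_* does not increase along the trajectory, and the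
    terminal cost is V_0 <= V_*. *)
Lemma cost2_le_Vlim eta (x0 : 'cV[R]_n) :
  minimizing_law B Q S (fun y Z => (Vlim y Z)%:E) eta ->
  (cost2 A B Q S gamma eta x0 <= (Vlim x0 0)%:E)%E.
Proof.
move=> etaP; apply/ereal_supP => _ [v [N [x [u [Z [[[x00 Z0] xE ZE uE] ->]]]]]].
have Zpsd t : possemidef (Z t).
  by elim: t => [|t IH]; rewrite ?Z0 ?ZE;
    [exact: possemidef0|exact: possemidef_datum].
have step t : qnorm Q (x t) + qnorm S (u t) + Vlim (x t.+1) (Z t.+1) <=
    Vlim (x t) (Z t).
  rewrite -lee_fin -(bellman_Vlim hQ hS Vbounded) -(etaP _ _ (Zpsd t)) -uE.
  by apply: ereal_sup_ubound; exists (v t) => //; rewrite ZE xE EFinD.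
have telescope M : \sum_(t < M) (qnorm Q (x t) + qnorm S (u t)) +
    Vlim (x M) (Z M) <= Vlim x0 0.
  elim: M => [|M IH]; first by rewrite big_ord0 add0r x00 Z0.
  by apply: le_trans IH; rewrite big_ord_recr -addrA lerD2l step.
rewrite lee_fin; apply: le_trans (telescope N.+1); rewrite lerD2l.
by rewrite -lee_fin; exact: (Viter_le_Vlim Vbounded 0%N).
Qed.

End Game.

(** * Values and optimal laws of the two games *)

Theorem theorem1 (R : realType) (n m : nat)
  (A : 'M[R]_n) (B : 'M[R]_(n, m)) (Q : 'M[R]_n) (S : 'M[R]_m) (gamma : R)
  (hQ : posdef Q) (hS : posdef S) (hgamma : 0 < gamma) :
  let V := Viter A B Q S gamma in
  let bounded := forall x : 'cV[R]_n,
    exists M : R, forall k : nat, (V k x 0%R <= M%:E)%E in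
  ((forall x0 : 'cV[R]_n,
      value1 A B Q S gamma x0 \is a fin_num /\
      value2 A B Q S gamma x0 \is a fin_num)
   <-> bounded) /\
  (bounded ->
   exists Vstar : 'cV[R]_n -> 'M[R]_(n + n) -> R,
     let VstarE := fun x Z => (Vstar x Z)%:E in
     [/\ forall (x : 'cV[R]_n) (Z : 'M[R]_(n + n)), possemidef Z ->
           (fun k : nat => V k x Z) @ \oo --> VstarE x Z,
         forall x0 : 'cV[R]_n,
           value1 A B Q S gamma x0 = VstarE x0 0 /\
           value2 A B Q S gamma x0 = VstarE x0 0,
         exists eta : state_law, minimizing_law B Q S VstarE eta
       & forall eta : state_law, minimizing_law B Q S VstarE eta ->
           optimal2 A B Q S gamma eta /\
           optimal1 A B Q S gamma (law_of_state_law B eta)]).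
Proof.
move=> V bounded.
have lower k x0 : (V k x0 0%R <= value1 A B Q S gamma x0)%E.
  by apply/ereal_infP => _ [mu _ <-]; exact: Viter_le_cost1.
have values x0 : (value1 A B Q S gamma x0 <= value2 A B Q S gamma x0)%E.
  apply/ereal_infP => _ [eta _ <-].
  apply: le_trans (cost1_law_le_cost2 _ _ _ _ _ _ _).
  by apply: ereal_inf_lbound; exists (law_of_state_law B eta).
pose Vs := Vlim A B Q S gamma.
have Vs_le (b : bounded) x0 : ((Vs x0 0)%:E <= value1 A B Q S gamma x0)%E.
  by rewrite (VlimE b); apply/ereal_supP => _ [k _ <-].
have eta0P : bounded ->
    exists eta : state_law, minimizing_law B Q S (fun x Z => (Vs x Z)%:E) eta.
  move=> b.
  have /choice[f fP] : forall xZ : 'cV[R]_n * 'M[R]_(n + n), exists u,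
      (bellman_obj B Q S (fun x Z => (Vs x Z)%:E) xZ.1 xZ.2 u
        <= (Vs xZ.1 xZ.2)%:E)%E.
    by move=> [x Z]; exact: bellman_Vlim_attained.
  exists (fun x Z => f (x, Z)) => x Z _; apply/eqP; rewrite eq_le.
  rewrite {1}(bellman_Vlim hQ hS b) (fP (x, Z)) /=.
  by apply: ereal_inf_lbound; exists (f (x, Z)).
have upper (b : bounded) eta : minimizing_law B Q S (fun x Z => (Vs x Z)%:E) eta ->
    forall x0, (cost2 A B Q S gamma eta x0 <= (Vs x0 0)%:E)%E.
  by move=> etaP x0; exact: cost2_le_Vlim.
have value_eq (b : bounded) x0 : value1 A B Q S gamma x0 = (Vs x0 0)%:E /\
    value2 A B Q S gamma x0 = (Vs x0 0)%:E.
  have [eta /(upper b)/(_ x0) etaP] := eta0P b.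
  have v2 : (value2 A B Q S gamma x0 <= (Vs x0 0)%:E)%E.
    by apply: le_trans etaP; apply: ereal_inf_lbound; exists eta.
  split; apply/eqP; rewrite eq_le.
    by rewrite Vs_le // (le_trans (values x0)).
  by rewrite v2 (le_trans (Vs_le b x0)).
split.
  split=> [fin x0|b x0]; last by have [-> ->] := value_eq b x0.
  exists (fine (value1 A B Q S gamma x0)) => k.
  by have [v1 _] := fin x0; rewrite fineK.
move=> b; exists Vs; split.
- by move=> x Z _; exact: Viter_cvg.
- exact: value_eq.
- exact: eta0P.
move=> eta etaP; split=> x0; have [v1 v2] := value_eq b x0.
  apply/eqP; rewrite eq_le {1}v2 upper //=.
  by apply: ereal_inf_lbound; exists eta.
apply/eqP; rewrite eq_le {1}v1; apply/andP; split.
  exact: le_trans (cost1_law_le_cost2 _ _ _ _ _ _ _) (upper b eta etaP x0).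
by apply: ereal_inf_lbound; exists (law_of_state_law B eta).
Qed.
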